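(* Let $m$ and $F$ be positive integers such that $m\geq 3$, $F>2m$ and $m\nmid F$. If $S\in\mathscr L(m,F)$, then $[S]\cap\mathscr I(m,F)=\{U([S])\}$. Moreover, $$U([S])=S\cup\Big\{x\in\mathbb N\setminus S \;\Big|\; F-x\notin S \text{ and } x>\tfrac F2\Big\}.$$
   Context: $\mathbb N$ denotes the non-negative integers. A numerical semigroup is a submonoid $S$ of $(\mathbb N,+)$ with $\mathbb N\setminus S$ finite. Its multiplicity $\operatorname{m}(S)$ is the smallest positive integer in $S$; its Frobenius number $\operatorname{F}(S)$ is the largest integer not in $S$. A numerical semigroup is irreducible if it cannot be expressed as the intersection of two numerical semigroups properly containing it. $\mathscr L(m,F)$ (respectively $\mathscr I(m,F)$) is the set of all numerical semigroups (respectively all irreducible numerical semigroups) with multiplicity $m$ and Frobenius number $F$. For a numerical semigroup $S$, $\theta(S)=\{s\in S\mid \operatorname{m}(S)<s<\operatorname{F}(S)/2\}$. On $\mathscr L(m,F)$, $S\sim S'$ if and only if $\theta(S)=\theta(S')$, and $[S]=\{S'\in\mathscr L(m,F)\mid S\sim S'\}$. Finally $U([S])=\bigcup_{S'\in[S]}S'$. *)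

(* Defs.v *)
From mathcomp Require Import all_boot all_order all_algebra.
From mathcomp Require Import boolp classical_sets cardinality.

Set Implicit Arguments.
Unset Strict Implicit.
Unset Printing Implicit Defensive.

Import Order.TTheory GRing.Theory Num.Theory.
Local Open Scope classical_set_scope.
Local Open Scope nat_scope.

Definition numerical_semigroup (S : set nat) : Prop :=
  [/\ S 0, forall x y, S x -> S y -> S (x + y) & finite_set (~` S)].

Definition is_multiplicity (S : set nat) (m : nat) : Prop :=
  [/\ 0 < m, S m & forall n, 0 < n -> S n -> m <= n].

(* The default value 0 is never reached on a numerical semigroup. *)
Definition multiplicity (S : set nat) : nat := xget 0 (is_multiplicity S).

(* The maximum ranges over all integers, so that the Frobenius number of
   setT is -1. *)
Definition is_frobenius (S : set nat) (f : int) : Prop :=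
  ~ (Posz @` S) f /\ forall z : int, ~ (Posz @` S) z -> (z <= f)%R.

(* The default value 0 is never reached on a numerical semigroup. *)
Definition frobenius (S : set nat) : int := xget 0%R (is_frobenius S).

Definition irreducible_semigroup (S : set nat) : Prop :=
  numerical_semigroup S /\
  ~ exists T1 T2 : set nat,
      [/\ numerical_semigroup T1, numerical_semigroup T2,
          S `<` T1, S `<` T2 & S = T1 `&` T2].

Definition semigroups (m F : nat) : set (set nat) :=
  [set S | [/\ numerical_semigroup S, multiplicity S = m
             & frobenius S = Posz F]].

Definition irreducible_semigroups (m F : nat) : set (set nat) :=
  [set S | [/\ irreducible_semigroup S, multiplicity S = m
             & frobenius S = Posz F]].

(* s < F(S)/2 is written without division, as 2s < F(S) in int. *)
Definition theta (S : set nat) : set nat :=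
  [set s | [/\ S s, multiplicity S < s & (Posz (2 * s)%N < frobenius S)%R]].

Definition theta_class (m F : nat) (S : set nat) : set (set nat) :=
  [set S' | semigroups m F S' /\ theta S = theta S'].

Definition class_union (C : set (set nat)) : set nat :=
  \bigcup_(S' in C) S'.

(* Main.v *)
(** Membership in [U([S])] only depends on the part of [S] below [F/2]: for
    [x > F/2], [x] lies in [S ∪ {x ∉ S | F - x ∉ S, x > F/2}] iff [F - x ∉ S].
    That part is determined by [m] and [theta S], so this set, the completion
    of [S], is the same for all members of the class, and contains each of them.
    It is irreducible because any semigroup properly containing it contains [F].
    Conversely an irreducible [T] is the intersection of its completion with
    [T ∪ {F}], so that it equals its completion. *)
Require Import Defs.
From mathcomp Require Import all_boot all_order all_algebra.
From mathcomp Require Import boolp classical_sets cardinality.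
From mathcomp Require Import zify.
Import Order.TTheory GRing.Theory Num.Theory.
Local Open Scope classical_set_scope.
Local Open Scope nat_scope.

(** For [x > F] the integer difference is negative, while truncated subtraction gives [0], which may
    lie in [S]; the conjunct [x <= F] excludes this case. *)
Lemma image_Posz_subn (S : set nat) (F x : nat) :
  (Posz @` S) (Posz F - Posz x)%R <-> x <= F /\ S (F - x).
Proof.
split=> [[s Ss e]|[xF Sx]]; last by exists (F - x) => //; lia.
have -> : F - x = s by lia.
by split=> //; lia.
Qed.

Lemma multiplicityP (S : set nat) (m : nat) : 0 < m ->
  multiplicity S = m <-> is_multiplicity S m.
Proof.
move=> m0; split=> [e|hm].
  rewrite /multiplicity in e; case: xgetP e => [y -> hy <- //|_ e].
  by rewrite -e in m0.
apply: xget_unique => // n [n0 Sn nmin]; case: hm => _ Sm mmin.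
by apply/eqP; rewrite eqn_leq nmin ?mmin.
Qed.

Lemma frobeniusP (S : set nat) (F : nat) : 0 < F ->
  frobenius S = Posz F <-> ~ S F /\ forall n, F < n -> S n.
Proof.
move=> F0; split=> [e|[nSF SF]].
  have [nSF Fmax] : is_frobenius S (Posz F).
    rewrite /frobenius in e; case: xgetP e => [y -> hy <- //|_ e]; lia.
  split=> [SF|n Fn]; first by apply: nSF; exists F.
  apply: contrapT => nSn; suff : (Posz n <= Posz F)%R by lia.
  by apply: Fmax => -[k Sk [kn]]; apply: nSn; rewrite -kn.
have hF : is_frobenius S (Posz F).
  split=> [[k Sk [kF]]|[n nSn|n _]]; [by rewrite kF in Sk| |by lia].
  rewrite lez_nat leqNgt; apply/negP => Fn.
  by apply: nSn; exists n => //; exact: SF.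
apply: xget_unique => // z [nSz zmax].
by apply/eqP; rewrite eq_le zmax ?(hF.2 z) //; exact: hF.1.
Qed.

(** Cofiniteness is absorbed into the last clause, which confines the complement to [[0, F]]. *)
Lemma semigroupsP (m F : nat) (S : set nat) : 0 < m -> 0 < F ->
  semigroups m F S <->
  [/\ S 0, forall x y, S x -> S y -> S (x + y), is_multiplicity S m,
      ~ S F & forall n, F < n -> S n].
Proof.
move=> m0 F0; split=> [[[S0 SD _] /(multiplicityP _ _ m0) Sm]|[S0 SD Sm nSF SF]].
  by move=> /(frobeniusP _ _ F0)[].
split; [split=> //|exact/multiplicityP|exact/frobeniusP].
apply: (sub_finite_set _ (finite_II F.+1)) => n /= nSn.
by rewrite ltnS leqNgt; apply/negP => /SF.
Qed.

(** The right-hand side of the formula for [U([S])], with the difference taken in [nat]. *)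
Definition completion (F : nat) (S : set nat) : set nat :=
  S `|` [set x | [/\ ~ S x, ~ (x <= F /\ S (F - x)) & F < 2 * x]].

Section Completion.
Variables (m F : nat) (m_gt0 : 0 < m) (ltmF : 2 * m < F).

Let F_gt0 : 0 < F. Proof. by lia. Qed.

(** Otherwise [F = x + (F - x)] would lie in [S]. *)
Lemma semigroups_reflect (S : set nat) (x : nat) : semigroups m F S ->
  S x -> ~ (x <= F /\ S (F - x)).
Proof.
move=> /(semigroupsP _ _ _ m_gt0 F_gt0)[_ SD _ nSF _] Sx [xF SFx].
by apply: nSF; rewrite -(subnKC xF); exact: SD.
Qed.

Lemma semigroups_half (S : set nat) (x : nat) : semigroups m F S ->
  2 * x = F -> ~ S x.
Proof.
move=> hS xF Sx; apply: (semigroups_reflect _ _ hS Sx).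
have -> : F - x = x by lia.
by split=> //; lia.
Qed.

Lemma completionE_low (S : set nat) (x : nat) : 2 * x <= F ->
  completion F S x <-> S x.
Proof. by move=> xF; split=> [[//|[_ _]]|]; [lia|left]. Qed.

Lemma completionE_high (S : set nat) (x : nat) : semigroups m F S ->
  F < 2 * x -> completion F S x <-> ~ (x <= F /\ S (F - x)).
Proof.
move=> hS Fx; split=> [[Sx|[]//]|nS]; first exact: semigroups_reflect hS Sx.
by have [Sx|nSx] := pselect (S x); [left|right].
Qed.

Lemma sub_completion (S : set nat) : S `<=` completion F S.
Proof. by move=> x; left. Qed.

Lemma completion_semigroups (S : set nat) : semigroups m F S ->
  semigroups m F (completion F S).
Proof.
move=> hS; have := hS.
move=> /(semigroupsP _ _ _ m_gt0 F_gt0)[S0 SD [_ Sm mmin] nSF SF].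
have SVD x y : S x -> completion F S y -> completion F S (x + y).
  move=> Sx [Sy|[nSy nFy Fy]]; first by left; exact: SD.
  apply/completionE_high => //; first by lia.
  (* If [F - (x + y)] were in [S], adding [x] would put [F - y] in [S]. *)
  move=> [xyF SFxy]; apply: nFy; split; first by lia.
  have -> : F - y = x + (F - (x + y)) by lia.
  exact: SD.
apply/semigroupsP => //; split.
- by left.
- move=> x y [Sx|Vx] Vy; first exact: SVD.
  case: Vy => [Sy|Vy]; first by rewrite addnC; apply: SVD => //; right.
  (* Two added elements both exceed [F/2], so their sum exceeds [F]. *)
  by left; apply: SF; case: Vx Vy => [_ _ Fx] [_ _ Fy]; lia.
- split=> //; first by left.
  (* Added elements exceed [F/2], hence [m]. *)
  by move=> n n0 [/mmin -> //|[_ _ Fn]]; lia.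
- move=> [//|[_ nF0 _]]; apply: nF0.
  by rewrite subnn.
- by move=> n /SF; left.
Qed.

Lemma completion_irreducible (S : set nat) : semigroups m F S ->
  irreducible_semigroups m F (completion F S).
Proof.
move=> hS; have hV := completion_semigroups S hS; have [nV mV FV] := hV.
have /(semigroupsP _ _ _ m_gt0 F_gt0)[_ _ _ nVF VF] := hV.
(* The completion contains [t] or [F - t] for every [t <= F] other than [F/2]. *)
have over T : numerical_semigroup T -> completion F S `<` T -> T F.
  move=> [_ TD _] [VT /existsNP[t /not_implyP[Tt nVt]]].
  have tF : t <= F by rewrite leqNgt; apply/negP => /VF.
  have [t2|t2] := eqVneq (2 * t) F; first by rewrite -t2 mul2n -addnn; exact: TD.
  suff /VT TFt : completion F S (F - t) by rewrite -(subnKC tF); exact: TD.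
  (* Above [F/2], [t] can be missing only because [F - t] is in [S]. Below, [F - t] lies in the
     upper half and could be missing only if [t] were in [S]. *)
  have [Ft|Ft] := ltnP F (2 * t).
    by left; apply: contrapT => nS; apply: nVt; apply/completionE_high => // -[].
  apply/completionE_high => //; first by lia.
  by rewrite subKn // => -[_ St]; apply: nVt; left.
split=> //; split=> // -[T1 [T2 [nT1 nT2 VT1 VT2 VE]]].
by apply: nVF; rewrite VE; split; exact: over.
Qed.

Lemma irreducible_completion (S : set nat) : irreducible_semigroups m F S ->
  completion F S = S.
Proof.
move=> [[nS irrS] mS FS]; have hS : semigroups m F S by [].
have /(semigroupsP _ _ _ m_gt0 F_gt0)[S0 SD [_ Sm mmin] nSF SF] := hS.
have hV := completion_semigroups S hS.
have /(semigroupsP _ _ _ m_gt0 F_gt0)[_ _ _ nVF _] := hV.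
apply: contrapT => VS; apply: irrS; exists (completion F S), (F |` S); split.
- by case: hV.
(* A sum with [F] as a summand is [F] itself or exceeds [F]. *)
- have FD y : (F |` S) (F + y).
    by have [->|y0] := posnP y; [left; rewrite addn0|right; apply: SF; lia].
  split; first by right.
  + move=> x y [->|Sx]; first by [].
    by case=> [->|Sy]; [rewrite addnC|right; exact: SD].
  + case: nS => _ _; apply: sub_finite_set => x /= nx Sx.
    by apply: nx; right.
- split; first exact: sub_completion.
  by move=> sub; apply: VS; apply/seteqP; split=> //; exact: sub_completion.
- split; first by move=> x; right.
  by move=> sub; apply: nSF; apply: sub; left.
- apply/seteqP; split=> [x Sx|x [Vx [xF|//]]]; first by split; [left|right].
  by rewrite xF in Vx.
Qed.

(** Up to [F/2], the only elements of [S] outside [theta S] are [0] and [m], which [T] shares; [F/2]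
    itself is not in [S], as its double is [F]. *)
Lemma theta_low (S T : set nat) (x : nat) :
  semigroups m F S -> semigroups m F T -> theta S = theta T ->
  2 * x <= F -> S x -> T x.
Proof.
move=> hS hT eST xF Sx; have [[_ mS FS] [_ mT FT]] := (hS, hT).
have /(semigroupsP _ _ _ m_gt0 F_gt0)[_ _ [_ _ mmin] _ _] := hS.
have /(semigroupsP _ _ _ m_gt0 F_gt0)[T0 _ [_ Tm _] _ _] := hT.
have [->//|x0] := posnP x.
have := mmin x x0 Sx; rewrite leq_eqVlt => /orP[/eqP <- //|mx].
have x2F : 2 * x != F by apply/eqP => /(semigroups_half S x hS).
suff : theta T x by case.
by rewrite -eST; split=> //; rewrite ?mS ?FS //; lia.
Qed.

Lemma theta_completion (S : set nat) : semigroups m F S ->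
  theta S = theta (completion F S).
Proof.
move=> hS; have [_ mS FS] := hS; have [_ mV FV] := completion_semigroups S hS.
apply/seteqP; rewrite /theta mS FS mV FV.
split=> x /= [Vx mx xF]; split=> //; first by left.
by apply/(completionE_low S x) => //; lia.
Qed.

(** Above [F/2], membership of [x] means absence of [F - x], so [theta_low] is used there from [T]
    to [S]. *)
Lemma completion_theta_sub (S T : set nat) :
  semigroups m F S -> semigroups m F T -> theta S = theta T ->
  completion F S `<=` completion F T.
Proof.
move=> hS hT eST x; have [xF|Fx] := leqP (2 * x) F.
  by move=> /(completionE_low _ _ xF) Sx; left; exact: theta_low eST xF Sx.
move=> /(completionE_high _ _ hS Fx) nS; apply/completionE_high => //.
move=> [xF TFx]; apply: nS; split=> //.
by apply: (theta_low T S) => //; lia.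
Qed.

Lemma class_union_completion (S : set nat) : semigroups m F S ->
  class_union (theta_class m F S) = completion F S.
Proof.
move=> hS; apply/seteqP; split=> [x [T [hT eST] Tx]|x Vx].
  by apply: (completion_theta_sub T S) => //; left.
(* The completion is itself a member of the class. *)
exists (completion F S) => //; split; first exact: completion_semigroups.
exact: theta_completion.
Qed.

End Completion.

Theorem theorem7 (m F : nat) (hm : 3 <= m) (hF : 2 * m < F)
    (hmF : ~~ (m %| F)) (S : set nat) (hS : semigroups m F S) :
  theta_class m F S `&` irreducible_semigroups m F
    = [set class_union (theta_class m F S)]
  /\ class_union (theta_class m F S)
    = S `|` [set x : nat | [/\ ~ S x, ~ (Posz @` S) (Posz F - Posz x)%R
                             & F < 2 * x]].
Proof.
have m0 : 0 < m by lia.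
rewrite (class_union_completion m F) //; split; last first.
  apply/seteqP; split=> x [Sx|[nSx nFx Fx]]; try by left.
    by right; split=> // /image_Posz_subn.
  by right; split=> // /image_Posz_subn.
apply/seteqP; split=> [T [[hT eST] iT]|T ->].
  (* [T] is its own completion, and completions agree throughout the class. *)
  rewrite /= -(irreducible_completion m F m0 hF T iT).
  by apply/seteqP; split; apply: (completion_theta_sub m F).
split; last exact: completion_irreducible.
split; first exact: completion_semigroups.
exact: (theta_completion m F).
Qed.
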